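(* If the $\infty$-Degree Conjecture is true, then the $\infty$-JC (the generalized Jacobian Conjecture over $\mathbb{C}$) is true.
   Context: For a $\mathbb{C}$-algebra endomorphism $F:\mathbb{C}[x_1,\ldots,x_n]\to\mathbb{C}[x_1,\ldots,x_n]$ write $F_i=F(x_i)$, $1\le i\le n$. We say $F$ has an invertible Jacobian if $\operatorname{Jac}(F_1,\ldots,F_n)=\det(\partial F_i/\partial x_j)\in\mathbb{C}^*$. Degrees of polynomials are total degrees. The $n$-JC is the statement: every $\mathbb{C}$-algebra endomorphism $F$ of $\mathbb{C}[x_1,\ldots,x_n]$ with an invertible Jacobian is an automorphism. The $\infty$-JC is the statement: the $n$-JC is true for all $n\ge 1$. The $n$-Degree Conjecture is the statement: for every $\mathbb{C}$-algebra endomorphism $F$ of $\mathbb{C}[x_1,\ldots,x_n]$ with an invertible Jacobian, if $d$ is the minimum of the degrees of $F_1,\ldots,F_n$, then the degree of the field extension $\mathbb{C}(F_1,\ldots,F_n)\subseteq\mathbb{C}(x_1,\ldots,x_n)$ is less than or equal to $d^{n-1}$. The $\infty$-Degree Conjecture is the statement: the $n$-Degree Conjecture is true for all $n\ge 2$. *)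

(* Defs.v *)
From mathcomp Require Import all_boot all_order all_algebra.
From mathcomp Require Import reals.
From mathcomp Require Import complex mpoly.

Set Implicit Arguments.
Unset Strict Implicit.
Unset Printing Implicit Defensive.

Import GRing.Theory.

Local Open Scope ring_scope.

Section FieldExtensionDegree.
Variable L : fieldType.
Implicit Types S K A : L -> Prop.

(* As x / 0 = 0 and 1 - 1 = 0, no side condition is needed. *)
Definition is_subfield S : Prop :=
  [/\ S 1,
      forall x y, S x -> S y -> S (x - y)
    & forall x y, S x -> S y -> S (x / y)].

Definition generated_subfield A : L -> Prop :=
  fun y => forall S, is_subfield S -> (forall a, A a -> S a) -> S y.

Definition is_basis_over K (m : nat) (b : 'I_m -> L) : Prop :=
  (forall y, exists a : 'I_m -> L,
     (forall i, K (a i)) /\ y = \sum_(i < m) a i * b i) /\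
  (forall a : 'I_m -> L, (forall i, K (a i)) ->
     \sum_(i < m) a i * b i = 0 -> forall i, a i = 0).

(* [L : K] is finite and equal to m. *)
Definition extension_degree K (m : nat) : Prop :=
  exists b : 'I_m -> L, is_basis_over K b.

End FieldExtensionDegree.

Section PolynomialEndomorphisms.
Variables (C : fieldType) (n : nat).
Local Notation P := {mpoly C[n]}.
Implicit Type F : {lrmorphism P -> P}.

Definition jacobian F : P :=
  \det (\matrix_(i < n, j < n) mderiv j (F 'X_i)).

Definition invertible_jacobian F : Prop :=
  exists2 c : C, c != 0 & jacobian F = c%:MP.

(* The inverse map of a bijective C-algebra endomorphism is automatically one. *)
Definition jacobian_conjecture : Prop :=
  forall F, invertible_jacobian F -> bijective F.

(* Since msize p = deg p + 1 for p != 0, this is the total degree, with the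
   convention that 0 has degree 0; no F 'X_i is 0 when the Jacobian of F is
   invertible. *)
Definition total_degree (p : P) : nat := (msize p).-1.

Definition is_min_degree F (d : nat) : Prop :=
  (exists i : 'I_n, total_degree (F 'X_i) = d) /\
  (forall i : 'I_n, (d <= total_degree (F 'X_i))%N).

(* C(F_1, ..., F_n) inside C(x_1, ..., x_n). *)
Definition image_subfield F : {fraction P} -> Prop :=
  generated_subfield (fun y : {fraction P} =>
    (exists c : C, y = tofrac c%:MP) \/
    (exists i : 'I_n, y = tofrac (F 'X_i))).

Definition degree_conjecture : Prop :=
  forall F, invertible_jacobian F ->
  forall d : nat, is_min_degree F d ->
  exists2 m : nat, extension_degree (image_subfield F) m
                 & (m <= d ^ n.-1)%N.

End PolynomialEndomorphisms.

Definition infty_jacobian_conjecture (C : fieldType) : Prop :=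
  forall n : nat, (1 <= n)%N -> jacobian_conjecture C n.

Definition infty_degree_conjecture (C : fieldType) : Prop :=
  forall n : nat, (2 <= n)%N -> degree_conjecture C n.

(* Main.v *)
(** Adjoin to F a new variable x_0 with x_0 |-> x_0. The extended endomorphism
    still has an invertible Jacobian, and its components have minimal degree 1,
    so the Degree Conjecture makes it birational. By Keller's theorem a
    birational endomorphism with invertible Jacobian is an automorphism;
    setting x_0 = 0 gives the surjectivity of F.

    For Keller's theorem, write x_i = F a / F b in lowest terms. If b is not
    constant, a prime p divides b but not a, while F p divides F a. Let q be a
    prime dividing F p. The derivations d/dF_k preserve C[x], and they show that
    the preimage of (q) under F has height one, so that it cannot contain both
    p and a. *)
Require Import Defs.
From HB Require Import structures.
From mathcomp Require Import all_boot all_order all_algebra.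
From mathcomp Require Import reals.
From mathcomp Require Import complex mpoly ring zify.
From mathcomp Require Import boolp.

Set Implicit Arguments.
Unset Strict Implicit.
Unset Printing Implicit Defensive.

Import GRing.Theory.

Local Open Scope ring_scope.

(** * Unique factorization *)

Section Divisibility.
Variable R : idomainType.
Implicit Types a b c p q u : R.

Definition divides a b := exists c, b = c * a.

Definition prime_element p :=
  [/\ p != 0, ~ divides p 1
    & forall a b, divides p (a * b) -> divides p a \/ divides p b].

(* The index counts the prime factors with multiplicity. *)
Inductive prime_product : nat -> R -> Prop :=
| PrimeProductUnit u : divides u 1 -> prime_product 0 u
| PrimeProductMul k p a :
    prime_element p -> prime_product k a -> prime_product k.+1 (p * a).

Definition ufd := forall a, a != 0 -> exists k, prime_product k a.

Lemma divides_refl a : divides a a.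
Proof. by exists 1; rewrite mul1r. Qed.

Lemma divides_trans b a c : divides a b -> divides b c -> divides a c.
Proof. by case=> x -> [y ->]; exists (y * x); rewrite mulrA. Qed.

Lemma divides_mull a b c : divides a b -> divides a (c * b).
Proof. by case=> x ->; exists (c * x); rewrite mulrA. Qed.

Lemma divides_mulr a b c : divides a b -> divides a (b * c).
Proof. by rewrite mulrC; apply: divides_mull. Qed.

Lemma dividesD a b c : divides a b -> divides a c -> divides a (b + c).
Proof. by case=> x -> [y ->]; exists (x + y); rewrite mulrDl. Qed.

Lemma dividesN a b : divides a b -> divides a (- b).
Proof. by case=> x ->; exists (- x); rewrite mulNr. Qed.

Lemma dividesB a b c : divides a b -> divides a c -> divides a (b - c).
Proof. by move=> ab ac; apply/dividesD/dividesN. Qed.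

Lemma divides1_mul a b : divides a 1 -> divides b 1 -> divides (a * b) 1.
Proof.
by case=> x ax [y yb]; exists (x * y); rewrite mulrACA -ax -yb mulr1.
Qed.

Lemma prime_product_mul_unit k u a :
  divides u 1 -> prime_product k a -> prime_product k (u * a).
Proof.
move=> u1 pa; elim: pa => {k a} [v v1|k p a pp _ IH].
  by constructor; apply: divides1_mul.
by rewrite mulrCA; constructor.
Qed.

Lemma prime_product_mul k l a b :
  prime_product k a -> prime_product l b -> prime_product (k + l) (a * b).
Proof.
move=> pa pb; elim: pa => {k a} [v v1|k p a pp _ IH].
  exact: prime_product_mul_unit.
by rewrite -mulrA addSn; constructor.
Qed.

Lemma prime_product_prime p : prime_element p -> prime_product 1 p.
Proof.
move=> pp; rewrite -[p]mulr1; do 2!constructor => //; exact: divides_refl.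
Qed.

Lemma prime_product_neq0 k a : prime_product k a -> a != 0.
Proof.
elim=> {k a} [u [x]|k p a [p0 _ _] _ a0]; last by rewrite mulf_neq0.
by apply: contra_eqN => /eqP->; rewrite mulr0 oner_eq0.
Qed.

(** Induction on the factorization of [p * a]. Its first prime [q] divides [p] or [a]: in the first
    case [p] and [q] are associates, in the second [q] is cancelled from [a] and the induction
    hypothesis applies. *)
Lemma prime_product_cancel k p a : prime_element p ->
  prime_product k (p * a) -> exists2 l, k = l.+1 & prime_product l a.
Proof.
move=> pp pa; move: (erefl (p * a)) pa; move: {2 3}(p * a) => b Eb pb.
elim: pb a Eb => {k b} [u u1|k q b qq pb IH] a Eb.
  case: pp => _ []; apply: divides_trans u1; rewrite -Eb.
  exact/divides_mulr/divides_refl.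
have [p0 p1 pD] := pp; have [q0 q1 qD] := qq.
have /qD[[w Ep]|[c Ea]] : divides q (p * a).
- by rewrite Eb; apply/divides_mulr/divides_refl.
- have /pD[[v Ew]|[v Eq]] : divides p (w * q) by rewrite -Ep; apply: divides_refl.
    case: q1; exists v; apply: (mulfI p0); rewrite mulr1 {1}Ep Ew; ring.
  have vw : 1 = v * w by apply: (mulfI p0); rewrite mulr1 {1}Ep Eq; ring.
  exists k => //.
  have -> : a = v * b.
    apply: (mulfI p0); rewrite Eb Eq; ring.
  by apply: prime_product_mul_unit => //; exists w; rewrite mulrC.
have Eb' : p * c = b by apply: (mulfI q0); rewrite -Eb Ea; ring.
have [l -> pc] := IH _ Eb'.
by exists l.+1 => //; rewrite Ea mulrC; constructor.
Qed.

Lemma prime_divisor_exists k a : ~ divides a 1 -> prime_product k a ->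
  exists2 q, prime_element q & divides q a.
Proof.
move=> a1 pa; case: pa a1 => {k a} [u //|k q x qq _ _].
by exists q => //; apply/divides_mulr/divides_refl.
Qed.

End Divisibility.
Arguments ufd R : clear implicits.

(** * Gauss's lemma and factorization in R[x] *)

Section PolynomialRing.
Variable R : idomainType.
Implicit Types (f g h : {poly R}) (c p : R).

(** Trivial content, phrased without gcds. *)
Definition primitive f := forall p, prime_element p -> ~ divides p%:P f.

Lemma divides_polyC_coef p f i : divides p%:P f -> divides p f`_i.
Proof. by case=> g ->; rewrite coefMC; exists g`_i. Qed.

Lemma divides_polyC c c' : divides c%:P c'%:P -> divides c c'.
Proof. by move/(divides_polyC_coef 0); rewrite coefC. Qed.

(** Gauss's lemma. If p divides f g, it divides one of the two leading coefficients; dropping that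
    leading term changes nothing modulo p and lowers the total size. *)
Lemma prime_element_polyC p : prime_element p -> prime_element p%:P.
Proof.
case=> p0 p1 pD; split=> [|/divides_polyC//|f g]; first by rewrite polyC_eq0.
have [N] := ubnP (size f + size g)%N.
elim: N f g => // N IH f g szN pfg.
have [->|f0] := eqVneq f 0; first by left; exists 0; rewrite mul0r.
have [->|g0] := eqVneq g 0; first by right; exists 0; rewrite mul0r.
have reduce h : h != 0 -> divides p (lead_coef h) ->
    exists h', [/\ (size h' < size h)%N & divides p%:P (h - h')].
  move=> h0 [c Ec]; exists (h - lead_coef h *: 'X^((size h).-1)); split.
    rewrite -[X in (_ < X)%N]prednK ?size_poly_gt0 // ltnS.
    apply/leq_sizeP => j; rewrite leq_eqVlt coefB coefZ coefXn => /orP[/eqP<-|ltj].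
      by rewrite eqxx mulr1 subrr.
    rewrite [(j == _)%N]eq_sym (ltn_eqF ltj) mulr0 subr0 nth_default //.
    by rewrite -[X in (X <= _)%N]prednK ?size_poly_gt0.
  by rewrite subKr Ec mulrC -scalerA -mul_polyC; apply/divides_mulr/divides_refl.
have : divides p (lead_coef f * lead_coef g).
  by rewrite -lead_coefM; apply: divides_polyC_coef.
case/pD => [/reduce-/(_ f0)|/reduce-/(_ g0)] [h [lt_h ph]].
  have [|||] := IH h g.
  - by move: szN lt_h; lia.
  - rewrite -[h](subKr f) mulrBl; apply: dividesB => //; exact: divides_mulr.
  - by move=> ?; left; rewrite -[f](subrK h); apply: dividesD.
  - by right.
have [|||] := IH f h.
- by move: szN lt_h; lia.
- rewrite -[h](subKr g) mulrBr; apply: dividesB => //; exact: divides_mull.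
- by left.
- by move=> ?; right; rewrite -[g](subrK h); apply: dividesD.
Qed.

Lemma prime_product_polyC k c : prime_product k c -> prime_product k c%:P.
Proof.
elim=> {k c} [u [x Ex]|k p a pp _ IH].
  by constructor; exists x%:P; rewrite -polyCM -Ex.
by rewrite polyCM; constructor=> //; apply: prime_element_polyC.
Qed.

(** Pulling out a prime constant removes one prime factor from the leading coefficient, so the
    process stops after at most [k] steps. *)
Lemma primitive_decomposition k f : prime_product k (lead_coef f) ->
  exists l c f0, [/\ prime_product l c, f = c%:P * f0 & primitive f0].
Proof.
elim: k f => [|k IH] f pf;
  have [?|/existsNP[p /not_implyP[pp /contrapT[g Ef]]]] := pselect (primitive f);
  try by exists 0, 1, f; split; rewrite ?mul1r //; constructor; apply: divides_refl.
  move: pf; rewrite Ef lead_coefM lead_coefC mulrC.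
  by case/(prime_product_cancel pp).
move: pf; rewrite Ef lead_coefM lead_coefC mulrC.
case/(prime_product_cancel pp) => _ [<-] /IH[l [c [f0 [pc -> f0P]]]].
exists l.+1, (p * c), f0; split=> //; first by constructor.
by rewrite polyCM; ring.
Qed.

(** Each prime factor of [c] divides [f * g] but not the primitive [f], so it can be cancelled from
    [g]. *)
Lemma primitive_cancel k c f g h : prime_product k c -> primitive f ->
  c%:P * h = f * g -> divides f h.
Proof.
move=> pc fP; elim: pc g => {k c} [u [x Ex]|k p a pp pa IH] g E.
  exists (x%:P * g); rewrite -mulrA [g * f]mulrC -E mulrA -polyCM -Ex polyC1.
  by rewrite mul1r.
have [p0 _ pD] := prime_element_polyC pp.
have /pD[/(fP _ pp)//|[g' Eg]] : divides p%:P (f * g).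
  by rewrite -E polyCM; do 2!apply: divides_mulr; apply: divides_refl.
by apply: (IH g'); apply: (mulfI p0); rewrite mulrA -polyCM E Eg; ring.
Qed.

(** Each prime factor of [c] is divided out of [g] or of [h]. Only constants are removed, so the
    sizes stay the same. *)
Lemma factor_cancel k c f g h : prime_product k c -> f != 0 ->
  c%:P * f = g * h ->
  exists g' h', [/\ f = g' * h', size g' = size g & size h' = size h].
Proof.
move=> pc f0; elim: pc g h => {k c} [u [x Ex]|k p a pp pa IH] g h E.
  have x0 : x != 0 by apply: contra_eqN Ex => /eqP->; rewrite mul0r oner_eq0.
  exists (x%:P * g), h; split=> //; last by rewrite mul_polyC size_scale.
  by rewrite -mulrA -E mulrA -polyCM -Ex polyC1 mul1r.
have [pn0 _ _] := pp.
have [p0 _ pD] := prime_element_polyC pp.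
have szp f' : size (f' * p%:P) = size f' by rewrite mulrC mul_polyC size_scale.
have /pD[[g' Eg]|[h' Eh]] : divides p%:P (g * h).
- by rewrite -E polyCM; do 2!apply: divides_mulr; apply: divides_refl.
- rewrite Eg szp; apply: IH; apply: (mulfI p0).
  by rewrite mulrA -polyCM E Eg; ring.
- rewrite Eh szp; apply: IH; apply: (mulfI p0).
  by rewrite mulrA -polyCM E Eh; ring.
Qed.

(** Here [w] is a gcd over the fraction field; the constants [c], [d], [e] clear the
    denominators. *)
Lemma pseudo_bezout f g : f != 0 ->
  exists (w z y u v : {poly R}) (c d e : R),
    [/\ c != 0, d != 0 & e != 0] /\
    [/\ c%:P * f = z * w, d%:P * g = y * w & u * f + v * g = e%:P * w].
Proof.
move=> f0.
have /Pdiv.Idomain.dvdpP[[c z] /= c0 Ef] := Pdiv.Idomain.dvdp_gcdl f g.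
have /Pdiv.Idomain.dvdpP[[d y] /= d0 Eg] := Pdiv.Idomain.dvdp_gcdr f g.
have [[u v] /Pdiv.Idomain.eqpP[[a b] /= /andP[a0 b0] E]] := Pdiv.Idomain.Bezoutp f g.
exists (gcdp f g), z, y, (a%:P * u), (a%:P * v), c, d, b; split=> //.
by rewrite !mul_polyC -!scalerAl -scalerDr E.
Qed.

Lemma irreducible_prime f : ufd R -> primitive f -> (1 < size f)%N ->
  (forall g h, f = g * h -> (size g < size f)%N -> ~ (size h < size f)%N) ->
  prime_element f.
Proof.
move=> facR fP sf irr; have f0 : f != 0 by rewrite -size_poly_gt0 ltnW.
split=> // [[x Ex]|g h [t Et]].
  have x0 : x != 0 by apply: contra_eqN Ex => /eqP->; rewrite mul0r oner_eq0.
  have := congr1 (fun q : {poly R} => size q) Ex.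
  rewrite size_poly1 size_mul //.
  by move: sf (size_poly_gt0 x); rewrite x0; lia.
have [w [z [y [u [v [c [d [e [[c0 d0 e0] [Ef Eg Ew]]]]]]]]]] := pseudo_bezout g f0.
have : z * w != 0 by rewrite -Ef mulf_neq0 ?polyC_eq0.
rewrite mulf_eq0 negb_or => /andP[z0 w0].
have szE : size f = (size z + size w).-1.
  by rewrite -size_mul // -Ef mul_polyC size_scale.
(* If the gcd [w] of [f] and [g] is a constant, Bezout's identity times [h] shows that [f] divides a
   constant multiple of [h]. *)
have [sw|sw] := leqP (size w) 1.
  right; have Ek := size1_polyC sw; set k := w`_0 in Ek.
  have ek0 : e * k != 0.
    by rewrite mulf_neq0 // -polyC_eq0 -Ek.
  have [n pn] := facR _ ek0.
  apply: (primitive_cancel (g := u * h + v * t) pn fP).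
  by rewrite polyCM -Ek -Ew mulrDl -[v * g * h]mulrA Et; ring.
(* If the cofactor [z] is a constant, [f] is associated to [w] over the fraction field and so
   divides a constant multiple of [g]. *)
have [sz|sz] := leqP (size z) 1.
  left; have Ek := size1_polyC sz; set k := z`_0 in Ek.
  have kd0 : k * d != 0.
    by rewrite mulf_neq0 // -polyC_eq0 -Ek.
  have [n pn] := facR _ kd0.
  apply: (primitive_cancel (g := c%:P * y) pn fP).
  by rewrite polyCM -Ek -mulrA Eg mulrCA -Ef; ring.
(* Otherwise [c%:P * f = z * w] yields a factorization of [f] into two smaller factors. *)
have [n pn] := facR _ c0.
have [g' [h' [/irr E sg sh]]] := factor_cancel pn f0 Ef.
by case: E; rewrite ?sg ?sh szE; move: sw sz; lia.
Qed.

(** Induction on the size: after the content is split off, the primitive part is a constant, or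
    irreducible and hence prime, or a product of two smaller polynomials. *)
Lemma ufd_poly : ufd R -> ufd {poly R}.
Proof.
move=> facR f; have [N] := ubnP (size f); elim: N f => // N IH f szN f0.
have [|n pn] := facR (lead_coef f); first by rewrite lead_coef_eq0.
have [l [c [g [pc Ef gP]]]] := primitive_decomposition pn.
have g0 : g != 0 by apply: contra_neq f0 => g0; rewrite Ef g0 mulr0.
have szg : size f = size g.
  rewrite Ef mul_polyC size_scale //; exact: prime_product_neq0 pc.
suff [k pk] : exists k, prime_product k g.
  exists (l + k)%N; rewrite Ef; apply: prime_product_mul => //.
  exact: prime_product_polyC.
have [sg|sg] := leqP (size g) 1.
  have Eg := size1_polyC sg; set a := g`_0 in Eg.
  have [|m pm] := facR a; first by rewrite -polyC_eq0 -Eg.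
  by exists m; rewrite Eg; apply: prime_product_polyC.
have [irr|] := pselect (forall g1 g2, g = g1 * g2 ->
    (size g1 < size g)%N -> ~ (size g2 < size g)%N).
  by exists 1; apply/prime_product_prime/irreducible_prime.
move=> /existsNP[g1 /existsNP[g2 /not_implyP[E /not_implyP[s1 /contrapT s2]]]].
have : g1 * g2 != 0 by rewrite -E.
rewrite mulf_eq0 negb_or => /andP[g10 g20].
have [||k1 p1] := IH g1 => //; first by move: szN s1; rewrite szg; lia.
have [||k2 p2] := IH g2 => //; first by move: szN s2; rewrite szg; lia.
by exists (k1 + k2)%N; rewrite E; apply: prime_product_mul.
Qed.

(* The gcd of g and h over the fraction field is constant, since the prime g
   divides neither a nonzero constant nor h. *)
Lemma prime_resultant g h : prime_element g -> ~ divides g h ->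
  exists u v c, c != 0 /\ u * g + v * h = c%:P.
Proof.
case=> g0 _ gD gh.
have [sg|sg] := leqP (size g) 1.
  exists 1, 0, g`_0; rewrite mul1r mul0r addr0 -size1_polyC //.
  by rewrite -polyC_eq0 -size1_polyC.
have gC c : c != 0 -> ~ divides g c%:P.
  move=> c0 [t Et]; have t0 : t != 0.
    by apply: contra_eqN Et => /eqP->; rewrite mul0r polyC_eq0.
  move: (congr1 (fun q : {poly R} => size q) Et) sg (size_poly_gt0 t).
  by rewrite size_mul // size_polyC c0 t0; lia.
have [w [z [y [u [v [c [d [e [[c0 d0 e0] [Eg Eh Ew]]]]]]]]]] := pseudo_bezout h g0.
have /gD[[t Ez]|[t Et]] : divides g (z * w).
- by rewrite -Eg; apply/divides_mull/divides_refl.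
- have Ec : c%:P = t * w.
    by apply: (mulfI g0); rewrite mulrC Eg Ez; ring.
  exists (t * u), (t * v), (e * c); rewrite mulf_neq0 //; split=> //.
  by rewrite -!mulrA -mulrDr Ew polyCM Ec; ring.
- have /gD[/(gC _ d0)//|//] : divides g (d%:P * h).
  by rewrite Eh Et; do 2!apply: divides_mull; apply: divides_refl.
Qed.

End PolynomialRing.

(** * Transport along ring isomorphisms *)

Section Transport.
Variables (R S : idomainType) (f : {rmorphism R -> S}).

Lemma divides_rmorph a b : divides a b -> divides (f a) (f b).
Proof. by case=> c ->; exists (f c); rewrite rmorphM. Qed.

End Transport.

Section Isomorphism.
Variables (R S : idomainType) (f : {rmorphism R -> S}) (g : {rmorphism S -> R}).
Hypotheses (fK : cancel f g) (gK : cancel g f).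

Lemma divides_iso a b : divides (f a) (f b) -> divides a b.
Proof. by move/(divides_rmorph g); rewrite !fK. Qed.

Lemma prime_element_iso p : prime_element p -> prime_element (f p).
Proof.
case=> p0 p1 pD; split=> [|/(divides_rmorph g)|a b /(divides_rmorph g)].
- by rewrite -(rmorph0 f) (can_eq fK).
- by rewrite fK rmorph1.
- by rewrite fK rmorphM => /pD[] /(divides_rmorph f); rewrite gK; [left|right].
Qed.

Lemma iso_combination a b u v :
  g (u * f a + v * f b) = g u * a + g v * b.
Proof. by rewrite rmorphD !rmorphM !fK. Qed.

Lemma ufd_iso : ufd R -> ufd S.
Proof.
move=> ufdR b b0; have [|k pk] := ufdR (g b).
  by rewrite -(rmorph0 g) (can_eq gK).
exists k; rewrite -(gK b); elim: pk => {k b b0} [u u1|k p a pp _ IH].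
  by constructor; rewrite -(rmorph1 f); apply: divides_rmorph.
by rewrite rmorphM; constructor => //; apply: prime_element_iso.
Qed.

End Isomorphism.

(** * Multivariate polynomials: derivatives and elimination *)

Section MultivariatePolynomials.
Variable K : idomainType.

Lemma mpoly_generators_ind n (P : {mpoly K[n]} -> Prop) :
  (forall c, P c%:MP) -> (forall i, P 'X_i) ->
  (forall p q, P p -> P q -> P (p + q)) ->
  (forall p q, P p -> P q -> P (p * q)) -> forall p, P p.
Proof.
move=> PC PX PD PM; elim/mpolyind => [|c m p _ _ Pp]; first by rewrite -mpolyC0.
apply: PD => //; rewrite -mul_mpolyC; apply: (PM) => //.
rewrite mpolyXE_id; apply: big_rec => [|i q _ Pq]; first by rewrite -mpolyC1.
apply: (PM) => //; elim: (m i) => [|k IH]; first by rewrite expr0 -mpolyC1.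
by rewrite exprS; apply: (PM).
Qed.

Lemma mpoly_rmorph_ext n (S : comNzRingType) (f g : {rmorphism {mpoly K[n]} -> S}) :
  (forall c, f c%:MP = g c%:MP) -> (forall i, f 'X_i = g 'X_i) -> f =1 g.
Proof.
move=> fgC fgX; elim/mpoly_generators_ind => // p q Ep Eq.
  by rewrite !rmorphD Ep Eq.
by rewrite !rmorphM Ep Eq.
Qed.

(** The chain rule. Both sides are additive in [p] and obey the Leibniz rule along [f], so constants
    and variables suffice. *)
Lemma mderiv_chain m n (f : {rmorphism {mpoly K[m]} -> {mpoly K[n]}}) j p :
  (forall c, f c%:MP = c%:MP) ->
  (f p)^`M(j) = \sum_(k < m) f p^`M(k) * (f 'X_k)^`M(j).
Proof.
move=> fC; elim/mpoly_generators_ind: p => [c|i|p q Ep Eq|p q Ep Eq].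
- rewrite fC mderivC big1 // => k _; by rewrite mderivC rmorph0 mul0r.
- rewrite (bigD1 i) //= mderivX mnm1E eqxx -[X in (X - _)%MM]add0m addmK.
  rewrite mpolyX0 scale1r rmorph1 mul1r.
  rewrite big1 ?addr0 // => k /negPf ki.
  by rewrite mderivX mnm1E eq_sym ki scale0r rmorph0 mul0r.
- rewrite rmorphD mderivD Ep Eq -big_split /=; apply: eq_bigr => k _.
  by rewrite mderivD rmorphD mulrDl.
- rewrite rmorphM mderivM Ep Eq big_distrl big_distrr -big_split /=.
  apply: eq_bigr => k _; rewrite mderivM rmorphD !rmorphM; ring.
Qed.

Lemma msize_mderiv n (i : 'I_n) (p : {mpoly K[n]}) :
  p != 0 -> (msize p^`M(i) < msize p)%N.
Proof.
move=> p0; rewrite [X in (X < _)%N]msizeE.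
rewrite -[X in (_ < X)%N]prednK ?ltnS; last first.
  by rewrite lt0n msize_poly_eq0.
apply/bigmax_leqP_seq => m; rewrite mcoeff_msupp mcoeff_mderiv => cm _.
have /msize_mdeg_lt : (m + U_(i))%MM \in msupp p.
  by rewrite mcoeff_msupp; apply: contra_neq cm => ->; rewrite mul0rn.
by rewrite mdegD mdeg1; lia.
Qed.

Lemma mderiv_eq0_mpolyC n (p : {mpoly K[n]}) : [pchar K] =i pred0 ->
  (forall i, p^`M(i) = 0) -> p = (p@_0)%:MP.
Proof.
move=> charK dp; apply/mpolyP => m; rewrite mcoeffC.
have [->|m0] := eqVneq m 0%MM; first by rewrite mulr1.
rewrite mulr0; have [i mi] : exists i, m i != 0%N.
  apply/existsP; rewrite -negb_forall; apply: contra m0 => /forallP H.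
  by apply/eqP/mnmP => i; rewrite mnm0E; apply/eqP.
(* This coefficient of the derivative is [m i] times that of [p] at [m], and [m i] is nonzero in
   characteristic 0. *)
have := congr1 (fun q : {mpoly K[n]} => q@_(m - U_(i))) (dp i).
rewrite mcoeff_mderiv mcoeff0 submK; last by rewrite lep1mP.
by move/eqP; rewrite -mulr_natr mulf_eq0 ((pcharf0P K).1 charK) orbF => /eqP.
Qed.

Lemma divides_mpoly1 n (p : {mpoly K[n]}) : divides p 1 -> msize p = 1%N.
Proof.
case=> q E; have : q * p != 0 by rewrite -E oner_eq0.
rewrite mulf_eq0 negb_or => /andP[q0 p0].
have : msize (q * p) = 1%N by rewrite -E msize1.
rewrite msizeM //; move: q0 p0; rewrite -!msize_poly_eq0; lia.
Qed.

Lemma divides_msize n (p q : {mpoly K[n]}) :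
  q != 0 -> divides p q -> (msize p <= msize q)%N.
Proof.
move=> q0 [t E]; move: q0; rewrite E mulf_eq0 negb_or => /andP[t0 p0].
rewrite msizeM //; move: t0; rewrite -msize_poly_eq0; lia.
Qed.

Section Isolate.
Variables (n : nat) (i : 'I_n.+1).

(** The isomorphism that makes x_i the outer indeterminate over the ring in the other variables;
    [unisolate] is its inverse. *)
Definition isolate : {mpoly K[n.+1]} -> {poly {mpoly K[n]}} :=
  mmap (polyC \o @mpolyC n K)
    (fun j => oapp (fun k => ('X_k)%:P) 'X (unlift i j)).

HB.instance Definition _ := GRing.RMorphism.on isolate.

Definition skip_var : {mpoly K[n]} -> {mpoly K[n.+1]} :=
  mmap (@mpolyC n.+1 K) (fun k => 'X_(lift i k)).

HB.instance Definition _ := GRing.RMorphism.on skip_var.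

Definition unisolate : {poly {mpoly K[n]}} -> {mpoly K[n.+1]} :=
  horner_eval 'X_i \o map_poly skip_var.

HB.instance Definition _ := GRing.RMorphism.on unisolate.

Lemma skip_varX k : skip_var 'X_k = 'X_(lift i k).
Proof. by rewrite /skip_var mmapX mmap1U. Qed.

Lemma skip_varC c : skip_var c%:MP = c%:MP.
Proof. by rewrite /skip_var mmapC. Qed.

Lemma unisolateC p : unisolate p%:P = skip_var p.
Proof. by rewrite /unisolate /= map_polyC /horner_eval hornerC. Qed.

Lemma unisolateX : unisolate 'X = 'X_i.
Proof. by rewrite /unisolate /= map_polyX /horner_eval hornerX. Qed.

Lemma isolateC c : isolate c%:MP = c%:MP%:P.
Proof. by rewrite /isolate mmapC. Qed.

Lemma isolateX : isolate 'X_i = 'X.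
Proof. by rewrite /isolate mmapX mmap1U unlift_none. Qed.

Lemma isolate_lift k : isolate 'X_(lift i k) = ('X_k)%:P.
Proof. by rewrite /isolate mmapX mmap1U liftK. Qed.

Lemma isolateK : cancel isolate unisolate.
Proof.
apply: (@mpoly_rmorph_ext _ _ (unisolate \o isolate) idfun) => /= [c|j].
  by rewrite isolateC unisolateC skip_varC.
have [k ->|->] := unliftP i j; last by rewrite isolateX unisolateX.
by rewrite isolate_lift unisolateC skip_varX.
Qed.

Lemma isolate_skip_var p : isolate (skip_var p) = p%:P.
Proof.
apply: (@mpoly_rmorph_ext _ _ (isolate \o skip_var) polyC) => /= [c|k].
  by rewrite skip_varC isolateC.
by rewrite skip_varX isolate_lift.
Qed.

Lemma unisolateK : cancel unisolate isolate.
Proof.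
elim/poly_ind => [|p c IH]; first by rewrite !rmorph0.
by rewrite !rmorphD !rmorphM /= IH unisolateX isolateX unisolateC isolate_skip_var.
Qed.

Lemma divides_isolate p q : divides (isolate p) (isolate q) -> divides p q.
Proof. exact: (divides_iso (f := isolate) (g := unisolate)) isolateK _ _. Qed.

Lemma prime_element_isolate p : prime_element p -> prime_element (isolate p).
Proof.
exact: (prime_element_iso (f := isolate) (g := unisolate)) isolateK unisolateK _.
Qed.

Lemma unisolate_combination p q u v :
  unisolate (u * isolate p + v * isolate q) = unisolate u * p + unisolate v * q.
Proof. exact: (iso_combination (f := isolate) (g := unisolate)) isolateK _ _ _ _. Qed.

Lemma mderiv_skip_var p : (skip_var p)^`M(i) = 0.
Proof.
rewrite (mderiv_chain (f := skip_var)); last exact: skip_varC.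
rewrite big1 // => k _; rewrite /= skip_varX mderivX mnm1E.
by rewrite eq_sym (negPf (neq_lift i k)) scale0r mulr0.
Qed.

End Isolate.

End MultivariatePolynomials.

(** The resultant of [g] and [h] as polynomials in x_i; the vanishing derivative records that x_i
    has been eliminated. *)
Lemma elimination (K : idomainType) n (i : 'I_n) (g h : {mpoly K[n]}) :
  prime_element g -> ~ divides g h ->
  exists u v, u * g + v * h != 0 /\ (u * g + v * h)^`M(i) = 0.
Proof.
case: n i g h => [[]//|n] i g h gg gh.
have [||u [v [c [c0 E]]]] := @prime_resultant _ (isolate i g) (isolate i h).
- exact: prime_element_isolate.
- by move/divides_isolate.
exists (unisolate i u), (unisolate i v).
have -> : unisolate i u * g + unisolate i v * h = skip_var i c.
  by rewrite -unisolate_combination E unisolateC.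
split; last exact: mderiv_skip_var.
apply: contra_neq c0 => c0; apply: polyC_inj.
by rewrite -(isolate_skip_var i) c0 rmorph0.
Qed.

Lemma ufd_mpoly (K : fieldType) n : ufd {mpoly K[n]}.
Proof.
elim: n => [|n IH].
  move=> p p0; exists 0; constructor; move: p0.
  rewrite [p]nvar0_mpolyC_eq // mpolyC_eq0 => c0.
  by exists (p@_0)^-1%:MP; rewrite -mpolyCM mulVf.
by apply: ufd_iso (ufd_poly IH); [apply: (@unisolateK K n ord0)|apply: isolateK].
Qed.

(** * Keller's theorem *)

Lemma exists_minimal T (P : T -> Prop) (mu : T -> nat) :
  (exists x, P x) -> exists2 x, P x & forall y, P y -> (mu x <= mu y)%N.
Proof.
case=> x; have [N] := ubnP (mu x); elim: N x => // N IH x lt_x Px.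
have [?|/existsNP[y /not_implyP[Py /negP]]] :=
  pselect (forall y, P y -> (mu x <= mu y)%N).
  by exists x.
by rewrite -ltnNge => lt_y; apply: IH Py; apply: leq_trans lt_y _.
Qed.

Section Keller.
Variables (C : fieldType) (n : nat).
Local Notation P := {mpoly C[n]}.
Variable F : {lrmorphism P -> P}.
Hypothesis charC : [pchar C] =i pred0.
Hypothesis jacF : invertible_jacobian F.

Lemma endo_mpolyC c : F c%:MP = c%:MP.
Proof. by rewrite -[c%:MP]mulr1 mul_mpolyC linearZ rmorph1. Qed.

(* By Cramer's rule the derivations d/dF_k of C(F_1, ..., F_n) extend to
   C[x_1, ..., x_n]. *)
Lemma dual_derivations : exists D : 'I_n -> P -> P,
  [/\ forall k p q, D k (p * q) = D k p * q + p * D k q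
    & forall k p, D k (F p) = F p^`M(k)].
Proof.
have [c c0 Ec] := jacF.
pose M := \matrix_(i < n, j < n) (F 'X_i)^`M(j).
exists (fun k p => \sum_j (c^-1%:MP * (\adj M) j k) * p^`M(j)); split=> k p.
  move=> q; rewrite big_distrl big_distrr -big_split /=; apply: eq_bigr => j _.
  rewrite mderivM; ring.
under eq_bigr => j _.
  rewrite (mderiv_chain (f := F)) ?big_distrr /=; last exact: endo_mpolyC.
  over.
(* For fixed [l] the inner sum is the entry (l, k) of [M *m \adj M], so only [l = k] survives and
   contributes the Jacobian [c]. *)
have factor l : \sum_j c^-1%:MP * (\adj M) j k * (F p^`M(l) * (F 'X_l)^`M(j))
    = F p^`M(l) * (c^-1%:MP * \sum_j (\adj M) j k * (F 'X_l)^`M(j)).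
  by rewrite !big_distrr /=; apply: eq_bigr => j _; ring.
rewrite exchange_big /= (bigD1 k) //= [X in _ + X]big1 ?addr0.
  rewrite (factor k).
  have := congr1 (fun A : 'M_n => A k k) (mul_mx_adj M).
  rewrite !mxE eqxx mulr1n -/(jacobian F) Ec => E.
  have -> : \sum_j (\adj M) j k * (F 'X_k)^`M(j) = c%:MP.
    by rewrite -[RHS]E; apply: eq_bigr => j _; rewrite [M k j]mxE mulrC.
  by rewrite -mpolyCM mulVf // mulr1.
move=> l lk; rewrite (factor l).
have := congr1 (fun A : 'M_n => A l k) (mul_mx_adj M).
rewrite !mxE (negPf lk) mulr0n => E.
have -> : \sum_j (\adj M) j k * (F 'X_l)^`M(j) = 0.
  by rewrite -[RHS]E; apply: eq_bigr => j _; rewrite [M l j]mxE mulrC.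
by rewrite !mulr0.
Qed.

Lemma mderiv_neq0 (p : P) : (1 < msize p)%N -> exists i, p^`M(i) != 0.
Proof.
move=> sp; apply/not_existsP => H.
suff Ep : p = (p@_0)%:MP by move: sp; rewrite Ep msizeC; case: eqP.
apply: mderiv_eq0_mpolyC => // i; apply/eqP/negPn/negP; exact: H.
Qed.

(** If F p = 0 then F (d_k p) = D_k (F p) = 0 for all k. By induction on the degree all d_k p
    vanish, so p is a constant, which F fixes. *)
Lemma endo_inj (p : P) : F p = 0 -> p = 0.
Proof.
have [D [DM DF]] := dual_derivations.
have D0 k : D k 0 = 0 by rewrite -[X in D k X](mulr0 0) DM mulr0 mul0r addr0.
have [N] := ubnP (msize p); elim: N p => // N IH p sp Fp.
have [//|p0] := eqVneq p 0.
suff Ep : p = (p@_0)%:MP by move: Fp; rewrite Ep endo_mpolyC.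
apply: mderiv_eq0_mpolyC => // k; apply: IH; last by rewrite -DF Fp D0.
exact: leq_trans (msize_mderiv k p0) _.
Qed.

Lemma endo_eq0 (p : P) : (F p == 0) = (p == 0).
Proof. by apply/eqP/eqP => [/endo_inj|->]; rewrite ?rmorph0. Qed.

Lemma endo_injective : injective F.
Proof. by move=> p q /eqP; rewrite -subr_eq0 -rmorphB endo_eq0 subr_eq0 => /eqP. Qed.

Lemma divides1_endo (p : P) : divides (F p) 1 -> divides p 1.
Proof.
move/divides_mpoly1/eqP/msize_poly1P => [c c0 E].
have /eqP : F (p - c%:MP) = 0 by rewrite rmorphB /= E endo_mpolyC subrr.
rewrite endo_eq0 subr_eq0 => /eqP->.
by exists c^-1%:MP; rewrite -mpolyCM mulVf.
Qed.

(** The preimage of (q) under F is a prime ideal, so it contains a prime factor of each of its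
    nonzero elements. *)
Lemma prime_dividing k (q a : P) : prime_element q -> prime_product k a ->
  divides q (F a) -> exists p b c, [/\ a = b * p * c, prime_element p & divides q (F p)].
Proof.
case=> q0 q1 qD; elim=> {k a} [u u1 qu|k p a pp _ IH].
  case: q1; apply: divides_trans qu _; rewrite -(rmorph1 F).
  exact: divides_rmorph.
rewrite rmorphM => /qD[qp|/IH[p' [b [c [-> pp' qp']]]]].
  by exists p, 1, a; rewrite mul1r.
by exists p', (p * b), c; split=> //; rewrite !mulrA.
Qed.

(* If q divides F p and F a, let I be the prime ideal of all f with q | F f and
   g a prime of I of least degree, so that q^2 does not divide F g. Elimination
   yields a nonzero r of I with d_i r = 0 and d_j r outside I. The derivation
   (d_i g)(F) D_j - (d_j g)(F) D_i kills F g, hence preserves q C[x]; applied to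
   F r it gives a contradiction. *)
Lemma no_common_prime_divisor (p a q : P) :
  prime_element p -> ~ divides p a -> prime_element q ->
  divides q (F p) -> ~ divides q (F a).
Proof.
move=> pp pa qq qp qa; have [D [DM DF]] := dual_derivations.
have [q0 q1 qD] := qq.
pose I (f : P) := divides q (F f).
have size_I f : f != 0 -> I f -> (1 < msize f)%N.
  move=> f0 If; rewrite ltnNge; apply/negP => /msize1_polyC Ef.
  apply: q1; apply: divides_trans If _; exists (F (f@_0)^-1%:MP).
  rewrite -rmorphM {2}Ef -mpolyCM mulVf ?rmorph1 //.
  by rewrite -(mpolyC_eq0 n) -Ef.
have [f [f0 If] fmin] : exists2 f, f != 0 /\ I f
    & forall h, h != 0 /\ I h -> (msize f <= msize h)%N.
  by apply: (@exists_minimal _ (fun f => f != 0 /\ I f)); exists p; case: pp.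
(* A prime factor [g] of [f] lying in [I] inherits the minimality of the degree. *)
have [k pf] := ufd_mpoly f0.
have [g [b [b' [Ef gg Ig]]]] := prime_dividing qq pf If.
have gmin h : h != 0 -> I h -> (msize g <= msize h)%N.
  move=> h0 Ih; apply: leq_trans (fmin h _) => //; apply: divides_msize => //.
  by rewrite Ef; apply/divides_mulr/divides_mull/divides_refl.
have [g0 g1 gD] := gg.
have [i di_g] := mderiv_neq0 (size_I _ g0 Ig).
have NI_dig : ~ I g^`M(i).
  by move=> /(gmin _ di_g); rewrite leqNgt msize_mderiv.
(* If [g] divides [p], the two are associates, so [g] does not divide [a]; thus [p] or [a] serves as
   [h]. *)
have [h Ih gh] : exists2 h, I h & ~ divides g h.
  have [[s Ep]|?] := pselect (divides g p); last by exists p.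
  exists a => // ga; apply: pa; apply: divides_trans ga.
  have [p0 p1 pD] := pp.
  have /pD[[t Es]|//] : divides p (s * g) by rewrite -Ep; apply: divides_refl.
  case: g1; exists t; apply: (mulfI p0); rewrite mulr1 {1}Ep Es; ring.
have [r [r0 Ir dir] rmin] : exists2 r, [/\ r != 0, I r & r^`M(i) = 0]
    & forall r', [/\ r' != 0, I r' & r'^`M(i) = 0] -> (msize r <= msize r')%N.
  apply: (@exists_minimal _ (fun r => [/\ r != 0, I r & r^`M(i) = 0])).
  have [u [v [e0 de]]] := elimination i gg gh.
  exists (u * g + v * h); split=> //.
  by rewrite /I rmorphD !rmorphM; apply: dividesD; apply: divides_mull.
have [j dj_r] := mderiv_neq0 (size_I _ r0 Ir).
have NI_djr : ~ I r^`M(j).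
  (* Partial derivatives commute, so d_j r is also free of x_i; being smaller than [r], it is not in
     [I]. *)
  move=> Idjr; have := rmin r^`M(j); rewrite leqNgt msize_mderiv //.
  by move=> /(_ _)/implyP; rewrite mderiv_comm dir linear0; apply.
pose theta f := F g^`M(i) * D j f - F g^`M(j) * D i f.
have thetaM u v : theta (u * v) = theta u * v + u * theta v.
  by rewrite /theta !DM; ring.
have theta_g : theta (F g) = 0 by rewrite /theta !DF mulrC subrr.
have theta_r : theta (F r) = F g^`M(i) * F r^`M(j).
  by rewrite /theta !DF dir rmorph0 mulr0 subr0.
have [u Eg] := Ig; have [v Er] := Ir.
have q_theta : divides q (theta q).
  (* With F g = u q, theta (F g) = 0 gives q | u theta(q). If q divided u, then q^2 would divide F
     g, and q would divide D_i (F g) = F (d_i g). *)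
  have /qD[qu|//] : divides q (u * theta q).
    move: theta_g; rewrite Eg thetaM => /eqP; rewrite addrC addr_eq0 => /eqP->.
    by apply/dividesN/divides_mull/divides_refl.
  case: NI_dig; rewrite /I -DF Eg DM.
  apply: dividesD; first by apply/divides_mull/divides_refl.
  exact: divides_mulr.
have : divides q (theta (F r)).
  rewrite Er thetaM; apply: dividesD; last exact: divides_mull.
  by apply/divides_mull/divides_refl.
by rewrite theta_r => /qD[].
Qed.

(** Lowest terms are reached by induction on the prime factors of the denominator: a prime shared
    with the numerator cancels, and any other contradicts [no_common_prime_divisor]. *)
Lemma birational_jacobian_surjective :
  (forall i, exists a b, b != 0 /\ 'X_i * F b = F a) ->
  forall i, exists a, 'X_i = F a.
Proof.
move=> birF i; have [a [b [b0 E]]] := birF i.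
have [k pb] := ufd_mpoly b0.
elim: pb a E => {k b b0 birF} [u [x Ex]|k p b pp _ IH] a E.
  by exists (a * x); rewrite rmorphM /= -E -mulrA -rmorphM [u * x]mulrC -Ex rmorph1 mulr1.
have [p0 p1 pD] := pp.
have Fp0 : F p != 0 by rewrite endo_eq0.
have [[c Ea]|pa] := pselect (divides p a).
  by apply: (IH c); apply: (mulfI Fp0); rewrite mulrCA -rmorphM E Ea -rmorphM mulrC.
have [k' pFp] := ufd_mpoly Fp0.
have [q qq qFp] := prime_divisor_exists (fun Fp1 => p1 (divides1_endo Fp1)) pFp.
case: (no_common_prime_divisor pp pa qq qFp).
by rewrite -E rmorphM; apply/divides_mull/divides_mulr.
Qed.

End Keller.

(** * Adjoining a variable *)

Lemma fractions_is_subfield (R : idomainType) (L : fieldType) (f : {rmorphism R -> L}) :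
  injective f -> is_subfield (fun z => exists a b, b != 0 /\ z = f a / f b).
Proof.
move=> f_inj; have f_neq0 b : b != 0 -> f b != 0.
  by rewrite -(rmorph0 f) (inj_eq f_inj).
have Sf a : exists c d, d != 0 /\ f a = f c / f d.
  by exists a, 1; rewrite oner_eq0 rmorph1 divr1.
split=> [|x y [a [b [b0 ->]]] [c [d [d0 ->]]]|x y [a [b [b0 ->]]] [c [d [d0 ->]]]].
- by rewrite -(rmorph1 f); apply: Sf.
- exists (a * d - c * b), (b * d); rewrite mulf_neq0 //; split=> //.
  rewrite rmorphB !rmorphM /=; field.
  by rewrite !f_neq0.
(* Division by zero returns 0, which is again a fraction. *)
- have [->|c0] := eqVneq c 0.
    by rewrite rmorph0 mul0r invr0 mulr0 -(rmorph0 f); apply: Sf.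
  exists (a * d), (b * c); rewrite mulf_neq0 //; split=> //.
  rewrite !rmorphM /=; field.
  by rewrite !f_neq0.
Qed.

(** The fractions form a subfield containing the generators, hence contain the generated one. *)
Lemma image_subfield_fraction (C : fieldType) n
    (F : {lrmorphism {mpoly C[n]} -> {mpoly C[n]}}) y :
  injective F -> image_subfield F y ->
  exists a b, b != 0 /\ y = tofrac (F a) / tofrac (F b).
Proof.
move=> F_inj /(_ (fun z => exists a b, b != 0 /\ z = tofrac (F a) / tofrac (F b))).
apply.
  apply: (fractions_is_subfield (f := @tofrac _ \o F)) => p q /eqP /=.
  by rewrite tofrac_eq => /eqP/F_inj.
move=> _ [[c ->]|[i ->]].
  by exists c%:MP, 1; rewrite oner_eq0 endo_mpolyC rmorph1 divr1.
by exists 'X_i, 1; rewrite oner_eq0 rmorph1 divr1.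
Qed.

(** An empty basis cannot span 1. For a single basis element b, 1 = u b gives b = 1/u, so every y =
    v b lies in K. *)
Lemma extension_degree_le1 (L : fieldType) (K : L -> Prop) m : is_subfield K ->
  extension_degree K m -> (m <= 1)%N -> forall y, K y.
Proof.
move=> [_ _ KD] [b [b_span _]] m1 y.
case: m b b_span m1 => [|[|//]] b b_span _.
  have [a [_]] := b_span 1; rewrite big_ord0 => /eqP.
  by rewrite oner_eq0.
have [u [Ku E1]] := b_span 1; have [v [Kv ->]] := b_span y.
rewrite big_ord1 in E1; rewrite big_ord1.
have u0 : u ord0 != 0.
  by apply: contra_eqN E1 => /eqP->; rewrite mul0r oner_eq0.
have -> : b ord0 = (u ord0)^-1 by apply: (mulfI u0); rewrite -E1 mulfV.
exact: KD.
Qed.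

Section AddVariable.
Variables (C : fieldType) (n : nat) (F : {lrmorphism {mpoly C[n]} -> {mpoly C[n]}}).

Definition extend_endo : {mpoly C[n.+1]} -> {mpoly C[n.+1]} :=
  mmap (@mpolyC n.+1 C)
    (fun j => oapp (fun k => skip_var ord0 (F 'X_k)) 'X_ord0 (unlift ord0 j)).

HB.instance Definition _ := GRing.RMorphism.on extend_endo.

Lemma extend_endo_is_scalable : scalable extend_endo.
Proof. by move=> c p; rewrite /extend_endo mmapZ mul_mpolyC. Qed.

HB.instance Definition _ :=
  GRing.isScalable.Build C {mpoly C[n.+1]} {mpoly C[n.+1]} *:%R extend_endo
    extend_endo_is_scalable.

Lemma extend_endo_ord0 : extend_endo 'X_ord0 = 'X_ord0.
Proof. by rewrite /extend_endo mmapX mmap1U unlift_none. Qed.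

Lemma extend_endo_lift k : extend_endo 'X_(lift ord0 k) = skip_var ord0 (F 'X_k).
Proof. by rewrite /extend_endo mmapX mmap1U liftK. Qed.

(** The row of x_0 is (1, 0, ..., 0); the remaining minor is the Jacobian matrix of F in the shifted
    variables. *)
Lemma jacobian_extend_endo : jacobian extend_endo = skip_var ord0 (jacobian F).
Proof.
rewrite /jacobian (expand_det_row _ ord0) big_ord_recl big1 ?addr0 => [|k _].
  rewrite mxE /= extend_endo_ord0 mderivX mnm1E eqxx.
  rewrite -[X in (X - _)%MM]add0m addmK mpolyX0 scale1r mul1r.
  rewrite /cofactor addn0 expr0 mul1r -det_map_mx; congr (\det _).
  apply/matrixP => i j; rewrite !mxE extend_endo_lift /=.
  rewrite (mderiv_chain (f := skip_var ord0)); last exact: skip_varC.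
  rewrite (bigD1 j) //= skip_varX mderivX mnm1E eqxx.
  rewrite -[X in (X - _)%MM]add0m addmK mpolyX0 scale1r mulr1.
  rewrite big1 ?addr0 // => l /negPf lj.
  by rewrite skip_varX mderivX mnm1E (inj_eq lift_inj) lj scale0r mulr0.
by rewrite mxE /= extend_endo_ord0 mderivX mnm1E scale0r mul0r.
Qed.

(** Setting x_0 = 0 intertwines the extension with F, so preimages under the extension specialize to
    preimages under F. *)
Lemma specialize_extend_endo p :
  (isolate ord0 (extend_endo p)).[0] = F (isolate ord0 p).[0].
Proof.
apply: (@mpoly_rmorph_ext _ _ _ (horner_eval 0 \o isolate ord0 \o extend_endo)
  (F \o (horner_eval 0 \o isolate ord0))) => [c|j] /=; rewrite /horner_eval.
  by rewrite /extend_endo mmapC isolateC hornerC endo_mpolyC.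
have [k ->|->] := unliftP ord0 j.
  by rewrite extend_endo_lift isolate_skip_var isolate_lift !hornerC.
by rewrite extend_endo_ord0 isolateX hornerX rmorph0.
Qed.

End AddVariable.

Lemma invertible_jacobian_extend_endo (C : fieldType) n
    (F : {lrmorphism {mpoly C[n]} -> {mpoly C[n]}}) :
  invertible_jacobian F -> invertible_jacobian (extend_endo F).
Proof.
by case=> c c0 E; exists c; rewrite // jacobian_extend_endo E skip_varC.
Qed.

Lemma min_degree_extend_endo (C : fieldType) n
    (F : {lrmorphism {mpoly C[n]} -> {mpoly C[n]}}) :
  [pchar C] =i pred0 -> invertible_jacobian F -> is_min_degree (extend_endo F) 1.
Proof.
move=> charC /invertible_jacobian_extend_endo jacG; split=> [|i].
  by exists ord0; rewrite /total_degree /= extend_endo_ord0 msizeX mdeg1.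
rewrite /total_degree ltnNge; apply/negP => sX.
have /msize1_polyC EX : (msize (extend_endo F 'X_i) <= 1)%N.
  by rewrite -subn_eq0 subn1 -leqn0.
set c := _@_0 in EX.
(* A component equal to a constant c would put x_i - c in the kernel, against injectivity. *)
have /(endo_inj charC jacG)/eqP : extend_endo F ('X_i - c%:MP) = 0.
  by rewrite rmorphB /= EX (endo_mpolyC (extend_endo F)) subrr.
rewrite subr_eq0 => /eqP /(congr1 (fun p : {mpoly C[n.+1]} => msize p)).
by rewrite msizeX mdeg1 msizeC; case: eqP.
Qed.

Lemma degree_conjecture_jacobian_conjecture (C : fieldType) n :
  [pchar C] =i pred0 -> degree_conjecture C n.+1 -> jacobian_conjecture C n.
Proof.
move=> charC degC F jacF.
have jacG := invertible_jacobian_extend_endo jacF.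
have [m ext] := degC _ jacG _ (min_degree_extend_endo charC jacF).
(* Minimal degree 1 turns the bound into 1^n = 1. *)
rewrite exp1n => m1.
have subK : is_subfield (image_subfield (extend_endo F)).
  split=> [S [S1 _ _] _ //|x y Kx Ky S subS AS|x y Kx Ky S subS AS].
    by have [_ SB _] := subS; apply: SB; [apply: Kx|apply: Ky].
  by have [_ _ SD] := subS; apply: SD; [apply: Kx|apply: Ky].
have birG i : exists a b, b != 0 /\ 'X_i * extend_endo F b = extend_endo F a.
  have := extension_degree_le1 subK ext m1 (tofrac 'X_i).
  case/(image_subfield_fraction (endo_injective charC jacG)) => a [b [b0 E]].
  exists a, b; split=> //; apply/eqP; rewrite -tofrac_eq tofracM E mulfVK //.
  by rewrite tofrac_eq0 (endo_eq0 charC jacG).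
(* Boolean equality lets [xchoose] select the inverse map below. *)
have surjF p : exists q, F q == p.
  elim/mpoly_generators_ind: p => [c|i|p q|p q].
  - by exists c%:MP; rewrite endo_mpolyC.
  - have [a E] := birational_jacobian_surjective charC jacG birG (lift ord0 i).
    exists (isolate ord0 a).[0].
    by rewrite -specialize_extend_endo -E isolate_lift hornerC.
  - by move=> [p' /eqP<-] [q' /eqP<-]; exists (p' + q'); rewrite rmorphD.
  - by move=> [p' /eqP<-] [q' /eqP<-]; exists (p' * q'); rewrite rmorphM.
exists (fun p => xchoose (surjF p)) => p; last exact/eqP/(xchooseP (surjF p)).
apply/eqP; rewrite -subr_eq0 -(endo_eq0 charC jacF) rmorphB subr_eq0.
exact: (xchooseP (surjF (F p))).
Qed.

Theorem proposition3p5 (R : realType) :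
  infty_degree_conjecture (complex R) -> infty_jacobian_conjecture (complex R).
Proof.
move=> degC n n1; apply: degree_conjecture_jacobian_conjecture.
  exact: Num.Theory.pchar_num.
(* From n >= 1 follows n + 1 >= 2, as the Degree Conjecture requires. *)
exact: degC.
Qed.
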